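(* Let $K$ be a field, let $I \subseteq K[x,y]$ be a proper monomial ideal and let $\overline{I}$ denote its integral closure. Then $$\mathrm{v}(\overline{I}) \le \mathrm{v}(I).$$
   Context: $K[x,y]$ is the standard graded polynomial ring in two variables. For a proper homogeneous ideal $I$ of a standard graded polynomial ring $R=K[x_1,\ldots,x_n]$, the v-number of $I$ is $$\mathrm{v}(I)=\min\{d\ge 0 : \text{there exist } f\in R_d \text{ and } \mathfrak p\in\operatorname{Ass}(I) \text{ such that } (I:f)=\mathfrak p\},$$ where $R_d$ is the space of homogeneous polynomials of degree $d$, $(I:f)=\{g\in R: gf\in I\}$, and $\operatorname{Ass}(I)$ is the set of associated primes of $R/I$. The integral closure $\overline{I}$ is the ideal of all $x\in R$ satisfying an equation $x^m+a_1x^{m-1}+\cdots+a_m=0$ with $m\ge 1$ and $a_i\in I^i$. *)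

(* Defs.v *)
From HB Require Import structures.
From mathcomp Require Import all_boot all_order all_algebra.
From mathcomp Require Import boolp.
From mathcomp Require Import mpoly.

Set Implicit Arguments.
Unset Strict Implicit.
Unset Printing Implicit Defensive.

Import GRing.Theory.
Local Open Scope ring_scope.

(* Subsets of a ring are collective predicates [{pred R}], as in MathComp's
   [ring_quotient]; [`[< P >]] (from [boolp]) turns an arbitrary proposition
   into a boolean, so no decidability restriction is implied. *)

Section Ideals.
Variable R : comNzRingType.
Implicit Types (S I J P : {pred R}) (f x : R).

Definition ideal_gen S : {pred R} :=
  [pred x | `[< exists2 s : seq (R * R),
                  all (fun p => p.2 \in S) s & x = \sum_(p <- s) p.1 * p.2 >]].

Definition ideal_mul I J : {pred R} :=
  ideal_gen [pred x | `[< exists a b, [/\ a \in I, b \in J & x = a * b] >]].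

Fixpoint ideal_exp I (k : nat) : {pred R} :=
  if k is k'.+1 then ideal_mul I (ideal_exp I k') else predT.

Definition colon I f : {pred R} := [pred g | g * f \in I].

(* [idealr_closed] includes [1 \notin P]. *)
Definition prime_ideal P : Prop := idealr_closed P /\ prime_idealr_closed P.

(* [P] is prime and is the annihilator of the class of some [f] in R/I. *)
Definition associated_prime I P : Prop :=
  prime_ideal P /\ exists f, colon I f =i P.

Definition integral_closure I : {pred R} :=
  [pred x | `[< exists m (a : nat -> R),
    [/\ (1 <= m)%N,
        forall i, (1 <= i <= m)%N -> a i \in ideal_exp I i &
        x ^+ m + \sum_(1 <= i < m.+1) a i * x ^+ (m - i) = 0] >]].

End Ideals.

Section VNumber.
Variables (K : fieldType) (n : nat).
Implicit Type I : {pred {mpoly K[n]}}.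

Definition monomial_ideal I : Prop :=
  exists M : {pred 'X_{1..n}},
    I =i ideal_gen [pred p | `[< exists2 m, m \in M & p = 'X_[K, m] >]].

Definition vnumber_cand I (d : nat) : Prop :=
  exists (f : {mpoly K[n]}) (P : {pred {mpoly K[n]}}),
    [/\ f \is d.-homog, associated_prime I P & colon I f =i P].

(* [is_vnumber I d] reads v(I) = d. It is a relation so that no junk value has
   to be chosen when the set of candidates is empty. *)
Definition is_vnumber I (d : nat) : Prop :=
  vnumber_cand I d /\ forall e, vnumber_cand I e -> (d <= e)%N.

Lemma is_vnumber_uniq I d e : is_vnumber I d -> is_vnumber I e -> d = e.
Proof.
move=> [cd dmin] [ce emin].
by apply/eqP; rewrite eqn_leq dmin ?emin.
Qed.

End VNumber.

(* Main.v *)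
Require Import Defs.
From HB Require Import structures.
From mathcomp Require Import all_boot all_order all_algebra.
From mathcomp Require Import boolp zify.
From mathcomp Require Import mpoly.

Set Implicit Arguments.
Unset Strict Implicit.
Unset Printing Implicit Defensive.

(* The monomials of I form an up-closed set S of N^2, and those of its integral
   closure are the lattice points T of the Newton polyhedron of S. For a
   monomial ideal the v-number is attained at a monomial x^a y^b such that
   (S : (a, b)) is generated by a set of variables, so everything takes place in
   the lattice. If (a, b) is such a point for S but not for T, then it is a
   socle point of S lying in T \ S. Take a minimal element t of T below (a, b).
   It is not in S, hence it lies on or above a segment joining two points of S,
   one to its lower right and one to its upper left. If the line from t to
   the former has slope at most -1, then t + (1, -1) is in T and t - (0, 1) is a socle
   point of T; otherwise t + (-1, 1) is in T and t - (1, 0) is a socle point.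
   Both have degree less than a + b. *)

(** * Up-closed subsets of the lattice, their Newton polyhedra and their corners *)

Section StaircaseCombinatorics.
Variable S : nat -> nat -> Prop.

Definition upset := forall a b c d, a <= c -> b <= d -> S a b -> S c d.

(* The lattice points satisfying every nonnegative linear inequality valid on S. *)
Definition hull a b := forall p q c,
  (forall x y, S x y -> c <= p * x + q * y) -> c <= p * a + q * b.

(* The colon (S : (a, b)) is generated by the variables of positive weight,
   that is, by none, one or both of them. *)
Definition corner a b := exists p q, forall x y,
  S (a + x) (b + y) <-> 0 < p * x + q * y.

Lemma sub_hull a b : S a b -> hull a b.
Proof. by move=> Sab p q c; apply. Qed.

(* Among the (x, y) with [P x y] and 0 < y <= B, one maximizing y / x. *)
Lemma max_slope (P : nat -> nat -> Prop) B :
    (forall x y, P x y -> 0 < x /\ 0 < y <= B) -> (exists x y, P x y) ->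
  exists x y, P x y /\ forall x' y', P x' y' -> y' * x <= y * x'.
Proof.
elim: B P => [|B IH] P bnd exP.
  by case: exP => x [y /bnd]; lia.
have [noB|/existsNP[x0 /contrapT Px0]] :=
    pselect (forall x, ~ P x B.+1).
  apply: IH => // x y Pxy; have := bnd _ _ Pxy.
  by have := noB x; case: (eqVneq y B.+1) => [<-|]; [|lia].
have: exists x, `[< P x B.+1 >] by exists x0; apply/asboolP.
case/ex_minnP => x1 /asboolP Px1 minx1.
(* These points are strictly steeper than [(x1, B.+1)]. By minimality of [x1] none has height
   [B.+1], so the induction hypothesis applies to them. *)
pose P' x y := P x y /\ B.+1 * x < y * x1.
have [exP'|noP'] := pselect (exists x y, P' x y).
  have [|//|x [y [[Pxy lt_xy] maxxy]]] := IH P'.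
    move=> x y [Pxy lt_xy]; have [? ?] := bnd _ _ Pxy; split=> //.
    case: (eqVneq y B.+1) => [yB|]; last lia.
    have: x1 <= x by apply: minx1; apply/asboolP; rewrite -yB.
    by move: lt_xy; rewrite yB; nia.
  exists x, y; split=> // x' y' Pxy'.
  have [le'|lt'] := leqP (y' * x1) (B.+1 * x'); last exact: maxxy.
  have [? ?] := bnd _ _ Px1.
  rewrite -(leq_pmul2r (m := x1)); last lia.
  have [? ?] := bnd _ _ Pxy'. nia.
exists x1, B.+1; split=> // x' y' Pxy'.
rewrite leqNgt; apply/negP => lt'; apply: noP'; exists x', y'; split=> //; lia.
Qed.

(* Farkas' lemma in the plane: if no segment joining two points of [S] passes
   below (a, b), then the steepest point of [S] to the lower right of (a, b)
   gives a separating weight, perturbed to be strict on that ray. *)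
Lemma hull_segment a b : upset -> hull a b -> ~ S a b ->
  exists p q r s, [/\ S (a + p) (b - q) /\ S (a - r) (b + s),
    0 < p, 0 < q <= b, 0 < r <= a & s * p <= q * r].
Proof.
move=> upS hab Sab.
have noS x y : S x y -> a < x \/ b < y.
  by move=> Sxy; have [|] := ltnP a x; have [|] := ltnP b y; auto;
     move=> le1 le2; case: Sab; apply: upS Sxy.
pose P p q := [/\ S (a + p) (b - q), 0 < p & 0 < q <= b].
have [exP|noP] := pselect (exists p q, P p q); last first.
  (* Every point of [S] now has height at least [b]; the factor [a.+1] makes one step up outweigh a
     loss of at most [a] in the abscissa. *)
  have := hab 1 a.+1 (a + a.+1 * b).+1.
  suff H : forall x y, S x y -> (a + a.+1 * b).+1 <= 1 * x + a.+1 * y.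
    by move/(_ H); lia.
  move=> x y Sxy; have := noS _ _ Sxy.
  have [lt_yb|] := ltnP y b; last by case: (ltngtP b y) => //; nia.
  case=> [lt_ax|]; last lia; case: noP; exists (x - a), (b - y); split; [|lia|lia].
  by rewrite subnKC ?subKn //; lia.
have [|p [q [[Sp p0 q0] maxpq]]] := @max_slope P b _ exP.
  by move=> x y [? ? ?].
apply: contrapT => noQ.
(* The form q x + p y is constant on the ray. Adding x to its multiple by [a.+1] makes the ray
   strict to the right of [(a, b)]; where the form is already larger, the gain of [a.+1] covers a
   loss of at most [a] in x. *)
have := hab (a.+1 * q + 1) (a.+1 * p)
            ((a.+1 * q + 1) * a + a.+1 * p * b).+1.
suff H : forall x y, S x y ->
    ((a.+1 * q + 1) * a + a.+1 * p * b).+1 <= (a.+1 * q + 1) * x + a.+1 * p * y.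
  by move/(_ H); lia.
move=> x y Sxy; have := noS _ _ Sxy.
suff: a < x /\ q * a + p * b <= q * x + p * y \/ q * a + p * b < q * x + p * y.
  by case=> [[]|]; nia.
have [lt_ax|le_xa] := ltnP a x.
  left; split=> //; have [le_by|lt_yb] := leqP b y; first nia.
  have /maxpq : P (x - a) (b - y).
    by split; [rewrite subnKC ?subKn //; lia|lia|lia].
  by rewrite mulnBl mulnBr; nia.
right; have lt_by : b < y by case: (noS _ _ Sxy); lia.
have [lt_xa|] := ltnP x a; last by nia.
have Ns : ~ (y - b) * p <= q * (a - x).
  move=> le; apply: noQ; exists p, q, (a - x), (y - b).
  by rewrite subKn ?subnKC //; [split=> //; lia|lia..].
by move/negP: Ns; rewrite -ltnNge; nia.
Qed.

Lemma corner_socle a b : upset -> ~ S a b -> S a.+1 b -> S a b.+1 -> corner a b.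
Proof.
move=> upS Sab SSab SaSb; exists 1, 1 => x y.
have [x0|x0] := posnP x; have [y0|y0] := posnP y; split; try lia.
- by rewrite x0 y0 !addn0.
- by move=> _; apply: upS SaSb; lia.
- by move=> _; apply: upS SSab; lia.
- by move=> _; apply: upS SSab; lia.
Qed.

Lemma corner_left a b : upset -> (forall x y, S x y -> a < x) -> S a.+1 b ->
  corner a b.
Proof.
move=> upS gtS Sab; exists 1, 0 => x y; split; first by move/gtS; lia.
by move=> ?; apply: upS Sab; lia.
Qed.

Lemma corner_bottom a b : upset -> (forall x y, S x y -> b < y) -> S a b.+1 ->
  corner a b.
Proof.
move=> upS gtS Sab; exists 0, 1 => x y; split; first by move/gtS; lia.
by move=> ?; apply: upS Sab; lia.
Qed.

Lemma corner_empty : (forall x y, ~ S x y) -> corner 0 0.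
Proof. by move=> S0; exists 0, 0 => x y; split=> // /S0. Qed.

(** If a nonempty [S] misses an axis, a point just outside its extreme column or row is a corner. If
    it meets both, take the last point outside [S] on the horizontal axis, then the last one above
    it: this is a socle point. *)
Lemma corner_exists : upset -> ~ S 0 0 -> exists a b, corner a b.
Proof.
move=> upS S00.
have [exS|/forallNP noS] := pselect (exists x y, S x y); last first.
  by exists 0, 0; apply: corner_empty => x y Sxy; apply: (noS x); exists y.
have : exists a, `[< exists b, S a b >] by case: exS => a Sa; exists a; apply/asboolP.
case/ex_minnP => [[|a]] /asboolP[b Sab] mina; last first.
  exists a, b; apply: corner_left => // x y Sxy.
  by apply: mina; apply/asboolP; exists y.
have : exists b, `[< exists a, S a b >].
  by case: exS => x [y Sxy]; exists y; apply/asboolP; exists x.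
case/ex_minnP => [[|c]] /asboolP[d Sdc] minc; last first.
  exists d, c; apply: corner_bottom => // x y Sxy.
  by apply: minc; apply/asboolP; exists x.
have : exists i, `[< S i 0 >] by exists d; apply/asboolP.
case/ex_minnP => [[|i]] /asboolP // Si mini.
have : exists j, `[< S i j >] by exists b; apply/asboolP; apply: upS Sab.
case/ex_minnP => [[|j]] /asboolP Sij minj.
  by have := mini _ (introT (asboolP _) Sij); lia.
exists i, j; apply: corner_socle => //; last by apply: upS Si.
by move/asboolP/minj; lia.
Qed.

Lemma hull_upset a b c d : a <= c -> b <= d -> hull a b -> hull c d.
Proof.
move=> le_ac le_bd hab p q e /hab; move/leq_trans; apply.
by rewrite leq_add ?leq_mul.
Qed.
End StaircaseCombinatorics.

Lemma corner_hull (S : nat -> nat -> Prop) a b : upset S -> corner S a b ->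
  exists a' b', a' + b' <= a + b /\ corner (hull S) a' b'.
Proof.
move=> upS [p [q Sab]]; have upT : upset (hull S) by move=> *; apply: hull_upset; eauto.
have subT := @sub_hull S.
have [p0|p0] := posnP p; have [q0|q0] := posnP q.
- exists 0, 0; split; first lia.
  (* [S] is empty here, so the inequality 1 <= 0 is vacuously valid on it and excludes every point
     from the hull. *)
  apply: corner_empty => x y /(_ 0 0 1); apply/not_implyP; split=> //.
  move=> x' y' Sxy; suff: S (a + x') (b + y') by rewrite Sab; lia.
  by apply: upS Sxy; lia.
(* [S] lies strictly above height [b]. This linear inequality passes to the hull, so [(a, b)]
   remains a corner. *)
- exists a, b; split=> //; apply: corner_bottom => //.
    move=> x y /(_ 0 1 b.+1) H; suff: b.+1 <= 0 * x + 1 * y by lia.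
    apply: H => x' y' Sxy; rewrite mul1n ltnNge; apply/negP => le.
    suff: S (a + x') (b + 0) by rewrite Sab; lia.
    by apply: upS Sxy; lia.
  by apply: subT; rewrite -addn1 -(addn0 a) Sab; lia.
- exists a, b; split=> //; apply: corner_left => //.
    move=> x y /(_ 1 0 a.+1) H; suff: a.+1 <= 1 * x + 0 * y by lia.
    apply: H => x' y' Sxy; rewrite mul1n addn0 ltnNge; apply/negP => le.
    suff: S (a + 0) (b + y') by rewrite Sab; lia.
    by apply: upS Sxy; lia.
  by apply: subT; rewrite -addn1 -(addn0 b) Sab; lia.
have SSab : S a.+1 b by rewrite -addn1 -(addn0 b) Sab; lia.
have SaSb : S a b.+1 by rewrite -addn1 -(addn0 a) Sab; lia.
have {p q p0 q0} Sab : ~ S a b by rewrite -[a]addn0 -[b]addn0 Sab; lia.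
have [Tab|Tab] := pselect (hull S a b); last first.
  by exists a, b; split=> //; apply: corner_socle => //; apply: subT.
pose Q n := exists x y, [/\ x <= a, y <= b, x + y = n & hull S x y].
have : exists n, `[< Q n >] by exists (a + b); apply/asboolP; exists a, b.
case/ex_minnP => _ /asboolP [x [y [le_xa le_yb <- Txy]]] minxy.
have minT x' y' : x' <= x -> y' <= y -> hull S x' y' -> x + y <= x' + y'.
  move=> ? ? Txy'; apply: minxy; apply/asboolP; exists x', y'.
  by split=> //; lia.
have Sxy : ~ S x y by move=> Sxy; apply: Sab; apply: upS Sxy.
have [p [q [r [s [[SP SQ] p0 q0 r0 le]]]]] := hull_segment upS Txy Sxy.
have [le_pq|lt_qp] := leqP p q.
  exists x, y.-1; split; first lia.
  apply: corner_socle => //; [by move/minT; lia| |by rewrite prednK //; lia].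
  (* Add [p - 1] copies of the inequality at [(x, y)] to the one at the lower right point; as
     [p <= q], this bounds the value at (x + 1, y - 1). *)
  move=> u v c H; rewrite -(leq_pmul2l p0).
  have := H _ _ SP; have := Txy _ _ _ H; nia.
exists x.-1, y; split; first lia.
apply: corner_socle => //; [by move/minT; lia|by rewrite prednK //; lia|].
(* This follows from [s * p <= q * r] and [q < p]; the previous computation then applies with the
   coordinates exchanged. *)
have le_sr : s <= r by nia.
move=> u v c H; rewrite -(leq_pmul2l (m := r)); last lia.
have := H _ _ SQ; have := Txy _ _ _ H; nia.
Qed.

Import GRing.Theory.
Local Open Scope ring_scope.

(** * Powers of an ideal and integral equations *)

Section IdealPowers.
Variable R : comNzRingType.
Implicit Types (S I J : {pred R}) (x y : R).

Lemma ideal_gen0 S : 0 \in ideal_gen S.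
Proof. by apply/asboolP; exists [::]; rewrite ?big_nil. Qed.

Lemma mem_ideal_gen S x : x \in S -> x \in ideal_gen S.
Proof.
by move=> Sx; apply/asboolP; exists [:: (1, x)]; rewrite /= ?Sx // big_seq1 mul1r.
Qed.

Lemma ideal_genD S x y :
  x \in ideal_gen S -> y \in ideal_gen S -> x + y \in ideal_gen S.
Proof.
move=> /asboolP[s Ss ->] /asboolP[t St ->]; apply/asboolP.
by exists (s ++ t); rewrite ?all_cat ?Ss // big_cat.
Qed.

Lemma ideal_genM S x y : y \in ideal_gen S -> x * y \in ideal_gen S.
Proof.
move=> /asboolP[s Ss ->]; apply/asboolP; exists [seq (x * p.1, p.2) | p <- s].
  by rewrite all_map.
by rewrite big_map mulr_sumr; apply: eq_bigr => p _; rewrite mulrA.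
Qed.

Lemma ideal_gen_ind S (P : R -> Prop) : P 0 ->
    (forall x y, P x -> P y -> P (x + y)) ->
    (forall a x, x \in S -> P (a * x)) ->
  forall x, x \in ideal_gen S -> P x.
Proof.
move=> P0 PD PS _ /asboolP[s /allP Ss ->]; rewrite big_seq.
by apply: (big_ind P) => // p /Ss; apply: PS.
Qed.

Lemma ideal_exp0 I k : 0 \in ideal_exp I k.
Proof. by case: k => // k; apply: ideal_gen0. Qed.

Lemma ideal_expD I k x y :
  x \in ideal_exp I k -> y \in ideal_exp I k -> x + y \in ideal_exp I k.
Proof. by case: k => // k; apply: ideal_genD. Qed.

Lemma ideal_expMl I k x y : y \in ideal_exp I k -> x * y \in ideal_exp I k.
Proof. by case: k => // k; apply: ideal_genM. Qed.

Lemma ideal_expS I k x y :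
  x \in I -> y \in ideal_exp I k -> x * y \in ideal_exp I k.+1.
Proof.
by move=> Ix Iy; apply: mem_ideal_gen; apply/asboolP; exists x, y.
Qed.

Lemma ideal_expM I i j x y :
  x \in ideal_exp I i -> y \in ideal_exp I j -> x * y \in ideal_exp I (i + j).
Proof.
elim: i => [|i IHi] in x * => [_|Ix] Iy; first exact: ideal_expMl.
move: x Ix; apply: ideal_gen_ind; first by rewrite mul0r ideal_exp0.
  by move=> x1 x2 Ix1 Ix2; rewrite mulrDl; apply: ideal_expD.
move=> a _ /asboolP[u [v [Iu Iv ->]]]; rewrite -!mulrA.
by apply: ideal_expMl; apply: ideal_expS => //; apply: IHi.
Qed.

Lemma ideal_expX I k x : x \in I -> x ^+ k \in ideal_exp I k.
Proof. by move=> Ix; elim: k => // k IHk; rewrite exprS; apply: ideal_expS. Qed.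

(** Setting [a 0 = 1] absorbs the leading term, so that the equation becomes one sum. *)
Lemma integral_closureP I x :
  reflect (exists m a, [/\ (0 < m)%N, a 0%N = 1,
             forall i, (i <= m)%N -> a i \in ideal_exp I i &
             \sum_(i < m.+1) a i * x ^+ (m - i) = 0])
          (x \in integral_closure I).
Proof.
apply: (iffP (asboolP _)) => [[m [a [m0 Ia Da]]]|[m [a [m0 a0 Ia Da]]]].
  exists m, (fun i => if i is 0%N then 1 else a i); split=> //.
    by case=> // i le_im; apply: Ia.
  rewrite big_ord_recl mul1r subn0 -[RHS]Da; congr (_ + _).
  by rewrite big_add1 big_mkord.
exists m, a; split=> // [i /andP[_]|]; first exact: Ia.
rewrite -[RHS]Da big_ord_recl a0 mul1r subn0; congr (_ + _).
by rewrite big_add1 big_mkord.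
Qed.

End IdealPowers.

(** * The Rees algebra; the integral closure is an ideal *)

Section ReesAlgebra.
Variables (R : comNzRingType) (I : {pred R}).

Definition rees : {pred {poly R}} :=
  [pred p : {poly R} | `[< forall i, p`_i \in ideal_exp I i >]].

Fact rees_subring_closed : subring_closed rees.
Proof.
split=> [|p q /asboolP Ip /asboolP Iq|p q /asboolP Ip /asboolP Iq]; apply/asboolP => i.
- by rewrite coef1; case: i => [|i]; rewrite ?ideal_exp0.
- by rewrite coefB -mulN1r; apply: ideal_expD => //; apply: ideal_expMl.
rewrite coefM; apply: (big_ind (fun x => x \in ideal_exp I i)).
- exact: ideal_exp0.
- exact: ideal_expD.
by move=> j _; rewrite -[X in ideal_exp I X](subnKC (leq_ord j)) ideal_expM.
Qed.
HB.instance Definition _ := GRing.isSubringClosed.Build _ rees rees_subring_closed.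

(** [integralOver] takes a ring morphism, so the subring is made a ring type of its own. *)
Record rees_algebra := ReesAlgebra { rees_val :> {poly R}; _ : rees_val \in rees }.
HB.instance Definition _ := [isSub for rees_val].
HB.instance Definition _ := [Choice of rees_algebra by <:].
HB.instance Definition _ := [SubChoice_isSubComNzRing of rees_algebra by <:].

(* An integral equation of x over I is the degree m part of a monic equation of
   degree m of x t over the Rees algebra, the sum of the I^i t^i. *)
Lemma integral_closure_rees x : x \in integral_closure I <->
  integralOver (val : rees_algebra -> {poly R}) (x%:P * 'X).
Proof.
split=> [/integral_closureP[m [a [m0 a0 Ia Da]]]|[p monp rootp]].
  have reesa i : (i <= m)%N -> a i *: 'X^i \in rees.
    move=> /Ia Iai; apply/asboolP => j; rewrite coefZ coefXn.
    by case: eqP => [->|_]; rewrite ?mulr1 ?mulr0 ?ideal_exp0.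
  (* The default 0 is never taken, since [m - j <= m]. *)
  pose c j : rees_algebra := insubd 0 (a (m - j)%N *: 'X^(m - j)).
  have valc j : val (c j) = a (m - j)%N *: 'X^(m - j).
    by rewrite val_insubd reesa ?leq_subr.
  have cm : c m = 1.
    by apply: val_inj; rewrite valc subnn a0 scale1r rmorph1.
  exists (\poly_(j < m.+1) c j).
    by rewrite monicE lead_coef_poly ?cm ?oner_eq0.
  apply/rootP; rewrite (@horner_coef_wide _ m.+1); last first.
    by apply: leq_trans (size_poly _ _) _; rewrite size_poly.
  transitivity ((\sum_(i < m.+1) a i * x ^+ (m - i))%:P * 'X^m : {poly R}).
    rewrite rmorph_sum mulr_suml (reindex_inj rev_ord_inj).
    apply: eq_bigr => i _; rewrite coef_map coef_poly /= subSS ltnS leq_subr.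
    have le_im : (i <= m)%N by rewrite -ltnS.
    rewrite valc (subKn le_im) exprMn -mul_polyC polyCM -(rmorphXn polyC).
    by rewrite -!mulrA; congr (_ * _); rewrite mulrCA -exprD subnKC.
  by rewrite Da mul0r.
have p0 := monic_neq0 monp.
set m := (size p).-1; have szp : size p = m.+1 by rewrite prednK // size_poly_gt0.
have pm : p`_m = 1 by apply/eqP; rewrite -monicE -/(lead_coef _).
apply/integral_closureP; exists m, (fun i => (val p`_(m - i))`_i); split.
(* In degree 0 the monic [p] would be 1, which has no root. *)
- rewrite lt0n; apply/eqP => m0; move/rootP: rootp.
  have -> : p = 1.
    by rewrite [p]size1_polyC ?szp ?m0 // -m0 pm.
  by rewrite rmorph1 hornerC; apply/eqP/oner_neq0.
- by rewrite subn0 pm rmorph1 coef1.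
- by move=> i _; have /asboolP := valP p`_(m - i); apply.
have /(congr1 (fun q : {poly R} => q`_m)) := rootP rootp.
rewrite coef0 (@horner_coef_wide _ m.+1); last first.
  by rewrite -szp; apply: size_poly.
rewrite coef_sum => Dp; rewrite -[RHS]Dp (reindex_inj rev_ord_inj).
apply: eq_bigr => i _; rewrite coef_map /= subSS.
have le_im : (i <= m)%N by rewrite -ltnS.
rewrite subKn // exprMn mulrA coefMXn ltnNge le_im /= -rmorphXn /=.
by rewrite coefMC.
Qed.

(** Elements integral over the Rees algebra are closed under addition, and x t + y t = (x + y) t. *)
Lemma integral_closureD x y : x \in integral_closure I ->
  y \in integral_closure I -> x + y \in integral_closure I.
Proof.
move=> /integral_closure_rees Ix /integral_closure_rees Iy.
by apply/integral_closure_rees; rewrite rmorphD mulrDl; apply: integral_add.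
Qed.

(** The equation of [y] is multiplied by [x ^+ m], one factor [x ^+ i] going to [a i]. *)
Lemma integral_closureMl x y : y \in integral_closure I ->
  x * y \in integral_closure I.
Proof.
move=> /integral_closureP[m [a [m0 a0 Ia Da]]].
apply/integral_closureP; exists m, (fun i => x ^+ i * a i); split=> //.
- by rewrite a0 mulr1.
- by move=> i le_im; rewrite ideal_expMl ?Ia.
transitivity (x ^+ m * \sum_(i < m.+1) a i * y ^+ (m - i)); last first.
  by rewrite Da mulr0.
rewrite mulr_sumr; apply: eq_bigr => i _.
have le_im : (i <= m)%N by rewrite -ltnS.
have -> : x ^+ m = x ^+ i * x ^+ (m - i) by rewrite -exprD subnKC.
by rewrite exprMn -!mulrA; congr (_ * _); rewrite mulrCA.
Qed.

Lemma integral_closure0 : 0 \in integral_closure I.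
Proof.
apply/integral_closure_rees; rewrite rmorph0 mul0r; exact: integral0.
Qed.

(** The equation is T^k - x^k = 0. *)
Lemma integral_closure_root x k : (0 < k)%N -> x ^+ k \in ideal_exp I k ->
  x \in integral_closure I.
Proof.
case: k => // k _ Ixk; apply/integral_closureP.
exists k.+1, (fun i => if i == 0 then 1 else if i == k.+1 then - x ^+ k.+1 else 0).
split=> // [i _|].
  case: eqP => [->//|_]; case: eqP => [->|_]; last exact: ideal_exp0.
  by rewrite -mulN1r; apply: ideal_expMl.
rewrite big_ord_recl big_ord_recr big1 /= => [|i _]; last first.
  by rewrite /bump /= add1n eqSS ltn_eqF ?mul0r.
by rewrite add0r /bump /= add1n eqxx subnn mul1r mulr1 subrr.
Qed.
End ReesAlgebra.

(** * Lower bounds on orders of vanishing pass to the integral closure *)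

Section OrderOfVanishing.
Variables (R : comNzRingType) (D : idomainType) (phi : {rmorphism R -> {poly D}}).
Variables (I : {pred R}) (c : nat).
Hypothesis ordI : forall a, a \in I -> exists q, phi a = q * 'X^c.

Lemma ideal_exp_order k a : a \in ideal_exp I k -> exists q, phi a = q * 'X^(c * k).
Proof.
elim: k a => [|k IHk] a; first by exists (phi a); rewrite muln0 expr0 mulr1.
move: a; apply: ideal_gen_ind; first by exists 0; rewrite rmorph0 mul0r.
  by move=> x y [p Dp] [q Dq]; exists (p + q); rewrite rmorphD Dp Dq mulrDl.
move=> a _ /asboolP[u [v [/ordI[p Dp] /IHk[q Dq] ->]]]; exists (phi a * p * q).
by rewrite !rmorphM Dp Dq mulnS exprD -!mulrA; do 2!congr (_ * _); rewrite mulrCA.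
Qed.

(* If phi x had order e < c, then in the integral equation the leading term
   phi (x ^+ m) would have order e * m and all the others a larger one. *)
Lemma integral_closure_order x : x \in integral_closure I ->
  exists q, phi x = q * 'X^c.
Proof.
move=> /integral_closureP[m [a [m0 a0 Ia Da]]].
have [e [g]] := multiplicity_XsubC (phi x) 0; rewrite subr0.
have [->|_ /= g0 Dx] := eqVneq (phi x) 0; first by exists 0; rewrite mul0r.
have [le_ce|lt_ec] := leqP c e.
  by exists (g * 'X^(e - c)); rewrite -mulrA -exprD subnK.
have /choice[b Db] : forall i, exists q, (i <= m)%N -> phi (a i) = q * 'X^(c * i).
  move=> i; have [/Ia /ideal_exp_order[q Dq]|_] := leqP i m; first by exists q.
  by exists 0.
have b0 : b 0%N = 1 by have := Db _ (leq0n m); rewrite a0 muln0 expr0 mulr1 rmorph1.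
(* This is the image of the integral equation divided by ['X^(e * m)]. At 0 only the term [g ^+ m]
   survives, although [g] does not vanish there. *)
pose h := \sum_(i < m.+1) b i * g ^+ (m - i) * 'X^((c - e) * i).
have h0 : h = 0.
  apply: (@mulfI _ ('X^(e * m))); first by rewrite expf_neq0 ?polyX_eq0.
  rewrite mulr0 -[RHS](rmorph0 phi) -Da rmorph_sum mulr_sumr; apply: eq_bigr => i _.
  have le_im : (i <= m)%N by rewrite -ltnS.
  rewrite rmorphM rmorphXn Db // Dx exprMn -exprM -!mulrA mulrCA; congr (_ * _).
  rewrite mulrCA [RHS]mulrCA; congr (_ * _); rewrite -!exprD; congr ('X^_).
  by nia.
move/negP: g0; case; have /(congr1 (horner^~ 0)) := h0.
rewrite /h big_ord_recl b0 mul1r subn0 muln0 expr0 mulr1 hornerD horner_sum big1.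
  by rewrite addr0 horner0 horner_exp => /eqP; rewrite expf_eq0 m0.
move=> i _; rewrite hornerM hornerXn expr0n /bump /= muln_eq0 subn_eq0 leqNgt lt_ec.
by rewrite mulr0.
Qed.

End OrderOfVanishing.

(** * Weights of monomials and primes generated by variables *)

Section WeightGrading.
Variables (K : idomainType) (n : nat) (w : 'I_n -> nat).

Definition weight (m : 'X_{1..n}) := (\sum_(i < n) w i * m i)%N.

(* The substitution x_i |-> x_i t^(w i). *)
Definition weight_hom : {mpoly K[n]} -> {poly {mpoly K[n]}} :=
  mmap (polyC \o @mpolyC n K) (fun i => ('X_i)%:P * 'X^(w i)).
HB.instance Definition _ := GRing.RMorphism.copy weight_hom
  (mmap (polyC \o @mpolyC n K) (fun i => ('X_i)%:P * 'X^(w i))).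

Lemma weight_homE f :
  weight_hom f = \sum_(m <- msupp f) (f@_m *: 'X_[m])%:P * 'X^(weight m).
Proof.
apply: eq_bigr => m _ /=; rewrite -mul_mpolyC polyCM -mulrA; congr (_ * _).
rewrite /mmap1 (eq_bigr (fun i => ('X_i ^+ m i)%:P * 'X^(w i * m i))); last first.
  by move=> i _; rewrite exprMn -polyC_exp exprM.
by rewrite big_split -rmorph_prod -mpolyXE_id -expr_sum.
Qed.

Lemma weight_hom_coef f d m :
  ((weight_hom f)`_d)@_m = if weight m == d then f@_m else 0.
Proof.
rewrite weight_homE coef_sum raddf_sum /= {3}[f]mpolyE raddf_sum /=.
have coefm m' : ((((f@_m' *: 'X_[m'])%:P * 'X^(weight m')) : {poly {mpoly K[n]}})`_d)@_m
    = if weight m == d then (f@_m' *: 'X_[m'])@_m else 0.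
  rewrite coefCM coefXn mcoeffZ mcoeffX.
  rewrite mulr_natr mcoeffMn mcoeffZ mcoeffX.
  have [->|_] := eqVneq m' m; last by rewrite mulr0 mul0rn if_same.
  by rewrite [d == _]eq_sym; case: eqP.
rewrite (eq_bigr _ (fun m' _ => coefm m')).
by case: ifP => // _; rewrite big1.
Qed.

(** The variables are kept beside t, so distinct monomials cannot cancel and the order in t is read
    off the support. *)
Lemma weight_hom_order f c :
  (exists q, weight_hom f = q * 'X^c) <->
  {in msupp f, forall m, (c <= weight m)%N}.
Proof.
split=> [[q Dq] m|f_c].
  rewrite mcoeff_msupp leqNgt => /negP fm; apply/negP => lt_mc; apply: fm.
  by have := weight_hom_coef f (weight m) m; rewrite eqxx Dq coefMXn lt_mc mcoeff0 => <-.
exists (drop_poly c (weight_hom f)).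
rewrite -[LHS](poly_take_drop c) (_ : take_poly c _ = 0) ?add0r //.
apply/polyP => d; rewrite coef_take_poly coef0; case: ifP => // lt_dc.
apply/mpolyP => m; rewrite weight_hom_coef mcoeff0; case: eqP => // wm.
apply/eqP; rewrite mcoeff_eq0; apply/negP => /f_c; rewrite wm leqNgt lt_dc //.
Qed.

(* P is the kernel of [weight_hom] followed by evaluation at t = 0. *)
Lemma prime_positive_weight (P : {pred {mpoly K[n]}}) :
  (forall f, f \in P <-> {in msupp f, forall m, (0 < weight m)%N}) ->
  prime_ideal P.
Proof.
move=> P_w.
have [phi memP] : exists phi : {rmorphism {mpoly K[n]} -> {mpoly K[n]}},
    forall f, (f \in P) = (phi f == 0).
  exists (horner_eval 0 \o weight_hom) => f /=.
  apply/idP/idP => [/P_w/weight_hom_order[q ->]|/factor_theorem[q Dq]].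
    by rewrite /horner_eval hornerM hornerX mulr0.
  by apply/P_w/weight_hom_order; exists q; rewrite Dq subr0.
split; first split.
- by rewrite memP rmorph0.
- by rewrite memP rmorph1 oner_eq0.
- move=> a u v; rewrite !memP rmorphD rmorphM => /eqP-> /eqP->.
  by rewrite mulr0 addr0.
by move=> u v; rewrite !memP rmorphM mulf_eq0.
Qed.

End WeightGrading.

(** Serves to find one power of a variable that moves every monomial of a support into [S]. *)
Lemma uniform_bound (T : eqType) (s : seq T) (Q : T -> nat -> Prop) :
    (forall x i j, (i <= j)%N -> Q x i -> Q x j) ->
    {in s, forall x, exists k, Q x k} ->
  exists k, {in s, forall x, Q x k}.
Proof.
move=> Qmono; elim: s => [|x s IHs] Qs; first by exists 0%N.
have [k Qk] := Qs x (mem_head x s).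
have [|l Ql] := IHs; first by move=> y sy; apply: Qs; rewrite inE sy orbT.
exists (maxn k l) => y; rewrite inE => /predU1P[->|/Ql].
  by apply: Qmono Qk; rewrite leq_maxl.
by apply: Qmono; rewrite leq_maxr.
Qed.

Lemma prime_idealX (R : comNzRingType) (P : {pred R}) x k :
  prime_ideal P -> x ^+ k \in P -> x \in P.
Proof.
case=> [[_ P1 _] Pprime]; elim: k => [|k IHk]; first by rewrite (negPf P1).
by rewrite exprS => /Pprime/orP[].
Qed.

(** * Monomial ideals in two variables and their exponent sets *)

Section TwoVariables.
Variable K : fieldType.
Implicit Types (I : {pred {mpoly K[2]}}) (S : nat -> nat -> Prop).

Definition mnm2 a b : 'X_{1..2} := [multinom nth 0%N [:: a; b] i | i < 2].

Lemma mnm2_fst a b : mnm2 a b ord0 = a. Proof. by rewrite mnmE. Qed.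
Lemma mnm2_snd a b : mnm2 a b ord_max = b. Proof. by rewrite mnmE. Qed.
Definition mnm2E := (mnm2_fst, mnm2_snd).

Lemma mnm2P (m m' : 'X_{1..2}) :
  m ord0 = m' ord0 -> m ord_max = m' ord_max -> m = m'.
Proof.
move=> e0 e1; apply/mnmP; case=> [[|[|//]] lti].
  by rewrite (_ : Ordinal lti = ord0) //; apply: val_inj.
by rewrite (_ : Ordinal lti = ord_max) //; apply: val_inj.
Qed.

Lemma sum_ord2 (F : 'I_2 -> nat) : (\sum_i F i = F ord0 + F ord_max)%N.
Proof.
rewrite big_ord_recl big_ord1; congr (_ + F _)%N; exact: val_inj.
Qed.

Lemma mnm2_monomial a b :
  'X_[mnm2 a b] = 'X_[mnm2 1 0] ^+ a * 'X_[mnm2 0 1] ^+ b :> {mpoly K[2]}.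
Proof.
rewrite !mpolyXn -mpolyXD; congr 'X_[_].
by apply: mnm2P; rewrite mnmDE !mulmnE !mnm2E; lia.
Qed.

Definition weight2 p q (i : 'I_2) : nat := nth 0%N [:: p; q] i.

Lemma weight2E p q m : weight (weight2 p q) m = (p * m ord0 + q * m ord_max)%N.
Proof. by rewrite /weight sum_ord2. Qed.

Definition staircase S I :=
  forall f, f \in I <-> {in msupp f, forall m : 'X_{1..2}, S (m ord0) (m ord_max)}.

Lemma monomial_staircase I : monomial_ideal I ->
  exists S, upset S /\ staircase S I.
Proof.
case=> M I_M.
exists (fun a b => exists2 m, m \in M & (m ord0 <= a)%N /\ (m ord_max <= b)%N).
split=> [a b c d le_ac le_bd [m Mm [? ?]]|f].
  by exists m => //; split; lia.
rewrite I_M; split.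
  move: f; apply: ideal_gen_ind => [m|f g If Ig m|g _ /asboolP[m Mm ->] k].
  - by rewrite msupp0.
  - by move=> /msuppD_le; rewrite mem_cat => /orP[/If|/Ig].
  rewrite (perm_mem (msuppMX _ _)) => /mapP[k' _ ->]; exists m => //.
  by rewrite !mnmDE !leq_addr.
move=> Sf; rewrite [f]mpolyE big_seq.
apply: (big_ind (fun g => g \in ideal_gen _)).
- exact: ideal_gen0.
- exact: ideal_genD.
move=> m /Sf[m' Mm' [le0 le1]].
have -> : m = (m - m' + m')%MM.
  by apply: mnm2P; rewrite mnmDE mnmBE subnK.
rewrite mpolyXD scalerAl; apply/ideal_genM/mem_ideal_gen/asboolP.
by exists m'.
Qed.

Section Staircase.
Variables (S : nat -> nat -> Prop) (I : {pred {mpoly K[2]}}).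
Hypotheses (upS : upset S) (SI : staircase S I).

Lemma staircaseX m : 'X_[m] \in I <-> S (m ord0) (m ord_max).
Proof.
rewrite SI msuppX; split=> [|Sm k]; first by apply; rewrite mem_head.
by rewrite inE => /eqP->.
Qed.

Lemma staircaseXM m f : 'X_[m] * f \in I <->
  {in msupp f, forall k : 'X_{1..2}, S (m ord0 + k ord0) (m ord_max + k ord_max)}.
Proof.
rewrite SI mulrC; split=> H k.
  by move=> fk; rewrite -!mnmDE; apply: H; rewrite (perm_mem (msuppMX _ _)) map_f.
by rewrite (perm_mem (msuppMX _ _)) => /mapP[k' /H Sk ->]; rewrite !mnmDE.
Qed.

(** A linear inequality valid on [S] bounds an order of vanishing on [I], hence on the integral
    closure. Conversely, by [hull_segment], a power of each monomial with exponent in the hull lies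
    in the same power of [I]. *)
Lemma staircase_integral_closure : staircase (hull S) (integral_closure I).
Proof.
move=> f; split=> [If m fm p q c Sc|Sf].
  have ordI a : a \in I -> exists h, weight_hom (weight2 p q) a = h * 'X^c.
    move=> /SI Ia; apply/weight_hom_order => k /Ia /Sc.
    by rewrite weight2E.
  have := integral_closure_order ordI If.
  by move/weight_hom_order/(_ m fm); rewrite weight2E.
rewrite [f]mpolyE big_seq.
apply: (big_ind (fun g => g \in integral_closure _)).
- exact: integral_closure0.
- exact: integral_closureD.
move=> m /Sf hm; rewrite -mul_mpolyC; apply: integral_closureMl.
have [Sm|Sm] := pselect (S (m ord0) (m ord_max)).
  apply: (@integral_closure_root _ _ _ 1) => //.
  by apply/ideal_expX/staircaseX.
have [p [q [r [s [[SP SQ] p0 q0 r0 le]]]]] := hull_segment upS hm Sm.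
apply: (@integral_closure_root _ _ _ (r + p)); first lia.
pose P := mnm2 (m ord0 + p) (m ord_max - q).
pose Q := mnm2 (m ord0 - r) (m ord_max + s).
(* The weights [r] and [p] balance the abscissas of [P] and [Q]; the surplus height [q * r - s * p]
   is nonnegative because the segment passes on or below [m]. *)
have -> : 'X_[m] ^+ (r + p) =
    'X_[mnm2 0 (q * r - s * p)] * ('X_[P] ^+ r * 'X_[Q] ^+ p) :> {mpoly K[2]}.
  rewrite !mpolyXn -!mpolyXD; congr 'X_[_]; apply: mnm2P.
    by rewrite !mnmDE !mulmnE !mnm2E; nia.
  by rewrite !mnmDE !mulmnE !mnm2E; nia.
apply/ideal_expMl/ideal_expM; apply/ideal_expX/staircaseX; by rewrite !mnm2E.
Qed.

(** The colon by this monomial consists of the polynomials whose monomials all have positive weight,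
    so it is prime. *)
Lemma corner_vnumber_cand a b : corner S a b -> vnumber_cand I (a + b).
Proof.
case=> p [q Sab]; exists 'X_[mnm2 a b], (colon I 'X_[mnm2 a b]).
split=> //; first by rewrite dhomogX /= mdegE sum_ord2 !mnm2E.
split; last by exists 'X_[mnm2 a b].
apply: (@prime_positive_weight _ _ (weight2 p q)) => f.
rewrite inE mulrC staircaseXM !mnm2E.
by split=> H m /H; rewrite weight2E Sab.
Qed.

(** Some monomial of the support of [f] is already a corner, and homogeneity gives it degree [d].
    Which one is chosen depends on the variables contained in [P]. *)
Lemma vnumber_cand_corner d : vnumber_cand I d ->
  exists a b, (a + b)%N = d /\ corner S a b.
Proof.
case=> f [P [/dhomogP homf [Pprime _] If_P]].
have [[_ P1 PD] Pmul] := Pprime.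
have memP m : 'X_[m] \in P <->
    {in msupp f, forall k : 'X_{1..2}, S (m ord0 + k ord0) (m ord_max + k ord_max)}.
  by rewrite -If_P -staircaseXM.
suff [u fu cor] : exists2 u, u \in msupp f & corner S (u ord0) (u ord_max).
  by exists (u ord0), (u ord_max); split=> //; rewrite -(homf u fu) /= mdegE sum_ord2.
have [u fu Su] : exists2 u, u \in msupp f & ~ S (u ord0) (u ord_max).
  apply: contrapT => noS; case/negP: P1; rewrite -mpolyX0; apply/memP => k fk.
  by rewrite !mnm0E; apply: contrapT => Sk; apply: noS; exists k.
have [Px|Px] := boolP ('X_[mnm2 1 0] \in P);
  have [Py|Py] := boolP ('X_[mnm2 0 1] \in P).
- exists u => //; move/memP: Px => /(_ u fu); move/memP: Py => /(_ u fu).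
  by rewrite !mnm2E => ? ?; apply: corner_socle.
(* No power of y lies in the prime [P], so some monomial of [f] stays outside [S] under all of them.
   Its whole column then misses [S]. *)
- have [k fk Sk] : exists2 k, k \in msupp f &
      forall i, ~ S (k ord0) (i + k ord_max).
    apply: contrapT => noS; case/negP: Py.
    have [||i Si] := @uniform_bound _ (msupp f)
        (fun k i => S (k ord0) (i + k ord_max)).
    + by move=> k i j le_ij; apply: upS; lia.
    + by move=> k fk; apply: contrapT => /forallNP Sk; apply: noS; exists k.
    apply: (@prime_idealX _ _ _ i) => //; rewrite mpolyXn; apply/memP => k fk.
    by rewrite !mulmnE !mnm2E mul0n mul1n; apply: Si.
  exists k => //; apply: corner_left => //; last first.
    by move/memP: Px => /(_ k fk); rewrite !mnm2E.
  move=> x y Sxy; rewrite ltnNge; apply/negP => le; apply: (Sk y).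
  by apply: upS Sxy; lia.
- have [k fk Sk] : exists2 k, k \in msupp f &
      forall i, ~ S (i + k ord0) (k ord_max).
    apply: contrapT => noS; case/negP: Px.
    have [||i Si] := @uniform_bound _ (msupp f)
        (fun k i => S (i + k ord0) (k ord_max)).
    + by move=> k i j le_ij; apply: upS; lia.
    + by move=> k fk; apply: contrapT => /forallNP Sk; apply: noS; exists k.
    apply: (@prime_idealX _ _ _ i) => //; rewrite mpolyXn; apply/memP => k fk.
    by rewrite !mulmnE !mnm2E mul0n mul1n; apply: Si.
  exists k => //; apply: corner_bottom => //; last first.
    by move/memP: Py => /(_ k fk); rewrite !mnm2E.
  move=> x y Sxy; rewrite ltnNge; apply/negP => le; apply: (Sk x).
  by apply: upS Sxy; lia.
(* A point of [S] above [u] would be the exponent of a monomial in [P], and primality would put a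
   variable in [P]. *)
exists u => //; exists 0%N, 0%N => x y; split=> // Sxy.
have : 'X_[mnm2 (u ord0 + x) (u ord_max + y)] \in P.
  by apply/memP => k _; rewrite !mnm2E; apply: upS Sxy; lia.
rewrite mnm2_monomial => /Pmul/orP[] /(prime_idealX Pprime).
  by rewrite (negPf Px).
by rewrite (negPf Py).
Qed.

End Staircase.
End TwoVariables.

(** * Existence of the v-numbers and their comparison *)

Lemma is_vnumber_exists (K : fieldType) n (I : {pred {mpoly K[n]}}) d :
  vnumber_cand I d -> exists v, is_vnumber I v.
Proof.
move=> candd.
have : exists e, `[< vnumber_cand I e >] by exists d; apply/asboolP.
case/ex_minnP => v /asboolP candv minv; exists v; split=> // e cande.
by apply: minv; apply/asboolP.
Qed.

Theorem theorem3p2 (K : fieldType) (I : {pred {mpoly K[2]}})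
    (Imon : monomial_ideal I) (Iproper : 1 \notin I) :
  exists vbar v : nat,
    [/\ is_vnumber (integral_closure I) vbar, is_vnumber I v & (vbar <= v)%N].
Proof.
have [S [upS SI]] := monomial_staircase Imon.
have [a [b cor]] : exists a b, corner S a b.
  apply: corner_exists => // S00; case/negP: Iproper; apply/SI => m.
  by rewrite msupp1 inE => /eqP->; rewrite !mnm0E.
have [v vI] := is_vnumber_exists (corner_vnumber_cand SI cor).
have [a' [b' [Dv corv]]] := vnumber_cand_corner upS SI vI.1.
have [c [d [le_cd corT]]] := corner_hull upS corv.
have candT := corner_vnumber_cand (staircase_integral_closure upS SI) corT.
have [vbar vT] := is_vnumber_exists candT.
by exists vbar, v; split=> //; rewrite -Dv (leq_trans (vT.2 _ candT)).
Qed.
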